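(* For integers $n\geq m\geq 2$ with $n-m$ odd, the polynomial $K_q(n,m)$ is symmetric and unimodal: writing $K_q(n,m)=\sum_{i=0}^{D}c_iq^i$ with $D=m(n-m)+m$, one has $c_i=c_{D-i}$ for all $0\le i\le D$, and $c_0\le c_1\le\cdots\le c_{\lfloor D/2\rfloor}\ge c_{\lfloor D/2\rfloor+1}\ge\cdots\ge c_D$.
   Context: For integers $n\ge m\ge 0$ the Gaussian polynomial is ${n\brack m}=\prod_{i=0}^{m-1}\frac{1-q^{n-i}}{1-q^{m-i}}$. For $n\geq 1$ and $0\le m\le n$, the $q$-Kaplansky number is $K_q(n,m)=\frac{1-q^{n+m}}{1-q^{n}}{n\brack m}$, a polynomial in $q$ of degree $m(n-m)+m$. *)

(* Defs.v *)
From HB Require Import structures.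
From mathcomp Require Import all_boot all_order all_algebra.
Set Implicit Arguments. Unset Strict Implicit. Unset Printing Implicit Defensive.
Import Order.TTheory GRing.Theory Num.Theory.
Local Open Scope ring_scope.

(* Gaussian polynomial [n brack m] = prod_{i<m} (1 - q^{n-i}) / (1 - q^{m-i}),
   realised as the exact polynomial quotient in {poly rat}. *)
Definition gauss (n m : nat) : {poly rat} :=
  (\prod_(i < m) (1 - 'X^(n - i))) %/ (\prod_(i < m) (1 - 'X^(m - i))).

Definition Kq (n m : nat) : {poly rat} :=
  ((1 - 'X^(n + m)) * gauss n m) %/ (1 - 'X^n).

(* Main.v *)
(* Put N = n - m + 1, which is even. The generating function of K_q(n, m) in m is
   (1 - q^N z^2) / ((1 - z)(1 - q z) ... (1 - q^N z)) for fixed N,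
   so K_q(n, m) counts by weight (x_j having weight j) the monomials of degree m
   in x_0, ..., x_N not divisible by x_0 x_N. These span a complement of the
   multiples of Q = sum_j (-1)^j C(N, j) x_j x_(N-j), whose leading monomial is
   x_0 x_N; evenness of N is needed for Q to be nonzero. The derivations
   raise : x_j |-> (N - j) x_(j+1) and lower : x_j |-> j x_(j-1) form an
   sl_2-action killing Q, hence act on the quotient by Q. As in any
   finite-dimensional sl_2-module, raise is injective on the weight spaces below
   the middle weight, so the coefficients increase up to D/2. *)
Require Import Defs.
From HB Require Import structures.
From mathcomp Require Import all_boot all_order all_algebra.
From mathcomp Require Import mpoly ring zify.
Set Implicit Arguments. Unset Strict Implicit. Unset Printing Implicit Defensive.
Import Order.TTheory GRing.Theory Num.Theory.
Local Open Scope ring_scope.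

(** * Polynomial derivations determined by their values on the variables *)

Section Derivations.
Variable n : nat.
Implicit Types (a b : 'I_n -> {mpoly rat[n]}) (p q : {mpoly rat[n]}).

Definition der a p : {mpoly rat[n]} := \sum_j a j * p^`M(j).

Lemma der_is_linear a : linear (der a).
Proof.
move=> c p q; rewrite /der scaler_sumr -big_split /=; apply: eq_bigr => j _.
by rewrite mderivD mderivZ mulrDr scalerAr.
Qed.
HB.instance Definition _ a :=
  GRing.isLinear.Build rat {mpoly rat[n]} {mpoly rat[n]} _ (der a)
    (der_is_linear a).

Lemma derM a p q : der a (p * q) = der a p * q + p * der a q.
Proof.
rewrite /der mulr_suml mulr_sumr -big_split; apply: eq_bigr => j _ /=.
by rewrite mderivM; ring.
Qed.

Lemma derU a i : der a 'X_i = a i.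
Proof.
rewrite /der (bigD1 i) //= big1 => [|j ne_ji]; last first.
  by rewrite mderivX mnm1E eq_sym (negbTE ne_ji) scale0r mulr0.
rewrite mderivX mnm1E eqxx scale1r addr0.
suff -> : (U_(i) - U_(i))%MM = 0%MM :> 'X_{1..n} by rewrite mpolyX0 mulr1.
by apply/mnmP => j; rewrite mnmBE mnm0E subnn.
Qed.

Lemma eq_der a b : a =1 b -> der a =1 der b.
Proof. by move=> ab p; apply: eq_bigr => j _; rewrite ab. Qed.

Lemma der_linear_coef a b (c : rat) p :
  der (fun j => c *: a j + b j) p = c *: der a p + der b p.
Proof.
rewrite /der scaler_sumr -big_split; apply: eq_bigr => j _ /=.
by rewrite mulrDl scalerAl.
Qed.

Lemma der0_coef p : der (fun=> 0) p = 0.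
Proof. by rewrite /der big1 // => j _; rewrite mul0r. Qed.

(** Each composite is a derivation plus a second-order part. The second-order parts agree because
    partial derivatives commute, so they cancel in the commutator. *)
Lemma der_comm a b p :
  der a (der b p) - der b (der a p)
  = der (fun j => der a (b j) - der b (a j)) p.
Proof.
have dd c d : der c (der d p) = der (fun j => der c (d j)) p
    + \sum_i \sum_j c i * d j * p^`M(j)^`M(i).
  rewrite {2}/der; under [X in _ = X + _]eq_bigr do rewrite mulr_suml.
  rewrite [X in _ = X + _]exchange_big -big_split; apply: eq_bigr => i _ /=.
  rewrite -big_split /= raddf_sum mulr_sumr; apply: eq_bigr => j _ /=.
  by rewrite mderivM; ring.
rewrite !dd [X in _ - (_ + X)]exchange_big /=.
under [X in _ - (_ + X)]eq_bigr do
  under eq_bigr do rewrite mderiv_comm [b _ * _]mulrC.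
rewrite opprD addrACA subrr addr0 /der -sumrB.
by apply: eq_bigr => j _; rewrite mulrBl.
Qed.

Lemma derX (d : 'I_n -> rat) (u : 'X_{1..n}) :
  der (fun j => d j *: 'X_j) 'X_[u] = (\sum_j (u j)%:R * d j) *: 'X_[u].
Proof.
rewrite /der scaler_suml; apply: eq_bigr => j _.
rewrite mderivX -!scalerAl -scalerAr scalerA mulrC.
(* Monomial subtraction is truncated, so restoring the factor ['X_j] gives back [u] only when
   [u j > 0]; otherwise the coefficient vanishes. *)
have [->|uj] := posnP (u j); first by rewrite mul0r !scale0r.
rewrite -mpolyXD; congr (_ *: 'X_[_]); apply/mnmP => i.
rewrite mnmDE mnmBE mnm1E; case: eqP => [<-|_] /=; last by rewrite subn0.
by rewrite add1n subn1 prednK.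
Qed.

(** Monomials are eigenvectors of a diagonal derivation, so coefficients can be compared one by one.
    Homogeneity in degree or weight thus becomes a condition on the support. *)
Lemma der_diag_eigen (d : 'I_n -> rat) (c : rat) p :
  (der (fun j => d j *: 'X_j) p = c *: p) <->
  (forall u, u \in msupp p -> \sum_j (u j)%:R * d j = c).
Proof.
have coef u : (der (fun j => d j *: 'X_j) p)@_u
    = (\sum_j (u j)%:R * d j) * p@_u.
  elim/mpolyind: p => [|x w r _ _ IHp]; first by rewrite linear0 mcoeff0 mulr0.
  rewrite linearP mcoeffD IHp /= mcoeffD mcoeffZ derX !mcoeffZ mcoeffX mulrDr.
  by case: eqP => [->|]; rewrite ?mulr0 // !mulr1 mulrC.
split=> [eq_p u | eq_c].
  rewrite mcoeff_msupp => nz; apply: (mulIf nz).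
  by rewrite -coef eq_p mcoeffZ.
apply/mpolyP => u; rewrite coef mcoeffZ.
have [/eq_c-> //|] := boolP (u \in msupp p).
by rewrite -mcoeff_eq0 => /eqP->; rewrite !mulr0.
Qed.

End Derivations.

(** * The sl_2-action and the invariant quadratic form *)

Section SL2.
Variable N : nat.
Notation mp := {mpoly rat[N.+1]}.
Implicit Types (p q v : mp).

(** Indexing by [nat] lets shifts of the index be written without bound proofs. An index above [N]
    falls back to 0, but in [raise] it comes with coefficient 0. *)
Definition x_ (j : nat) : mp := 'X_(inord j).

Lemma x_val (j : 'I_N.+1) : 'X_j = x_ j.
Proof. by rewrite /x_ inord_val. Qed.

Lemma der_x_ (a : nat -> mp) j :
  (j <= N)%N -> der (fun i : 'I_N.+1 => a i) (x_ j) = a j.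
Proof. by move=> le_jN; rewrite derU inordK. Qed.

Definition raise : mp -> mp := der (fun j : 'I_N.+1 => (N - j)%:R *: x_ j.+1).
Definition lower : mp -> mp := der (fun j : 'I_N.+1 => j%:R *: x_ j.-1).
(** The factor 1 gives the diagonal form that [derX] and [der_diag_eigen] expect. *)
Definition euler : mp -> mp := der (fun j : 'I_N.+1 => 1 *: 'X_j).
Definition weigh : mp -> mp := der (fun j : 'I_N.+1 => j%:R *: 'X_j).
HB.instance Definition _ := GRing.Linear.on raise.
HB.instance Definition _ := GRing.Linear.on lower.
HB.instance Definition _ := GRing.Linear.on euler.
HB.instance Definition _ := GRing.Linear.on weigh.

Lemma raiseM p q : raise (p * q) = raise p * q + p * raise q.
Proof. exact: derM. Qed.

Lemma lowerM p q : lower (p * q) = lower p * q + p * lower q.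
Proof. exact: derM. Qed.

Lemma eulerM p q : euler (p * q) = euler p * q + p * euler q.
Proof. exact: derM. Qed.

Lemma weighM p q : weigh (p * q) = weigh p * q + p * weigh q.
Proof. exact: derM. Qed.

Lemma raise_x j : (j <= N)%N -> raise (x_ j) = (N - j)%:R *: x_ j.+1.
Proof. exact: (der_x_ (fun j => (N - j)%:R *: x_ j.+1)). Qed.

Lemma lower_x j : (j <= N)%N -> lower (x_ j) = j%:R *: x_ j.-1.
Proof. exact: (der_x_ (fun j => j%:R *: x_ j.-1)). Qed.

Lemma euler_x j : euler (x_ j) = x_ j.
Proof. by rewrite /euler derU scale1r. Qed.

Lemma weigh_x j : (j <= N)%N -> weigh (x_ j) = j%:R *: x_ j.
Proof. by move=> le_jN; rewrite /weigh derU inordK. Qed.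

(** By [der_comm] both sides of a commutator relation come from derivations, so comparing values on
    variables suffices. The four relations that follow are proved the same way. *)
Lemma weigh_raise p : weigh (raise p) = raise (weigh p) + raise p.
Proof.
apply/eqP; rewrite addrC -subr_eq der_comm; apply/eqP/eq_der => j /=.
rewrite 2!linearZ /= -/raise -/weigh x_val raise_x -1?ltnS //.
have [lt_jN|le_Nj] := ltnP j N; last first.
  rewrite (eqP le_Nj). by rewrite !scale0r scaler0 subr0.
rewrite weigh_x // !scalerA -scalerBl -natr1; congr (_ *: _); ring.
Qed.

Lemma weigh_lower p : weigh (lower p) = lower (weigh p) - lower p.
Proof.
apply/eqP; rewrite addrC -subr_eq der_comm -scaleN1r -[_ *: _]addr0.
rewrite -[0](der0_coef p) -der_linear_coef; apply/eqP/eq_der => j /=.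
rewrite 2!linearZ /= -/lower -/weigh addr0 scaleN1r.
rewrite x_val lower_x -1?ltnS // weigh_x; last by have := ltn_ord j; lia.
case: (j : nat) => [|i] /=; first by rewrite !scale0r oppr0 addr0.
by rewrite !scalerA -scalerBl -scaleNr -natr1; congr (_ *: _); ring.
Qed.

Lemma euler_raise p : euler (raise p) = raise (euler p).
Proof.
apply/eqP; rewrite -subr_eq0 der_comm -[0](der0_coef p); apply/eqP/eq_der => j.
rewrite 2!linearZ /= -/raise -/euler x_val euler_x raise_x -1?ltnS //.
by rewrite scale1r subrr.
Qed.

Lemma euler_lower p : euler (lower p) = lower (euler p).
Proof.
apply/eqP; rewrite -subr_eq0 der_comm -[0](der0_coef p); apply/eqP/eq_der => j.
rewrite 2!linearZ /= -/lower -/euler x_val euler_x lower_x -1?ltnS //.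
by rewrite scale1r subrr.
Qed.

(** On [x_j] the coefficient is (N - j)(j + 1) - j(N - j + 1) = N - 2j. Hence the commutator acts on
    degree [d] and weight [i] as the scalar N d - 2i. *)
Lemma lower_raise_comm p :
  lower (raise p) - raise (lower p) = N%:R *: euler p - 2 *: weigh p.
Proof.
rewrite der_comm -scaleNr -[_ *: weigh p]addr0 -[0](der0_coef p).
rewrite -!der_linear_coef; apply: eq_der => j /=.
rewrite 2!linearZ /= -/raise -/lower addr0 x_val.
have le_jN : (j <= N)%N by rewrite -ltnS.
have -> : (N - j)%:R *: lower (x_ j.+1) = ((N - j)%:R * j.+1%:R) *: x_ j.
  have [lt_jN|le_Nj] := ltnP j N; first by rewrite lower_x // scalerA.
  by rewrite (eqP le_Nj) mul0r !scale0r.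
have -> : j%:R *: raise (x_ j.-1) = (j%:R * (N - j).+1%:R) *: x_ j.
  case: (j : nat) le_jN => [|i] /= lt_iN; first by rewrite mul0r !scale0r.
  by rewrite raise_x 1?ltnW // scalerA subnSK.
rewrite !scalerA -scalerBl -scalerDl; congr (_ *: _).
by rewrite -!natr1 natrB //; ring.
Qed.

Definition quad : mp :=
  \sum_(j < N.+1) ((-1) ^+ j * 'C(N, j)%:R) *: (x_ j * x_ (N - j)).

(** The [y]-term at j + 1 cancels the [z]-term at j, since (j + 1) C(N, j + 1) = (N - j) C(N, j) and
    the signs alternate. The two boundary terms carry the factor 0. *)
Lemma quad_shift (y z : nat -> mp) (f : nat -> mp) :
  (forall j, (j <= N)%N -> f j = (j%:R *: y j + (N - j)%:R *: z j)) ->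
  (forall j, (j < N)%N -> y j.+1 = z j) ->
  \sum_(j < N.+1) ((-1) ^+ j * 'C(N, j)%:R) *: f j = 0.
Proof.
move=> fE yz.
under eq_bigr => j _ do
  rewrite fE -1?ltnS // scalerDr !scalerA.
rewrite big_split /= big_ord_recl mulr0 scale0r add0r.
rewrite [X in _ + X]big_ord_recr /= subnn mulr0 scale0r addr0 -big_split /=.
apply: big1 => j _; rewrite yz // -scalerDl -!mulrA -!natrM.
by rewrite mulnC mul_bin_left mulnC exprS mulN1r mulNr addNr scale0r.
Qed.

Lemma raise_quad : raise quad = 0.
Proof.
rewrite linear_sum; under eq_bigr do rewrite linearZ /=.
apply: (@quad_shift (fun j => x_ j * x_ (N - j).+1)
                    (fun j => x_ j.+1 * x_ (N - j))
                    (fun j => raise (x_ j * x_ (N - j)))) => j le_jN; last first.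
  by rewrite subnSK.
rewrite /= raiseM !raise_x ?leq_subr // subKn //.
by rewrite -scalerAl -scalerAr addrC.
Qed.

Lemma lower_quad : lower quad = 0.
Proof.
rewrite linear_sum; under eq_bigr do rewrite linearZ /=.
apply: (@quad_shift (fun j => x_ j.-1 * x_ (N - j))
                    (fun j => x_ j * x_ (N - j).-1)
                    (fun j => lower (x_ j * x_ (N - j)))) => j le_jN; last first.
  by rewrite /= subnS.
rewrite /= lowerM !lower_x ?leq_subr //.
by rewrite -scalerAl -scalerAr.
Qed.

Definition quad_dvd p := exists u, p = quad * u.

Lemma quad_dvdD p q : quad_dvd p -> quad_dvd q -> quad_dvd (p + q).
Proof. by move=> [u ->] [v ->]; exists (u + v); rewrite mulrDr. Qed.

Lemma quad_dvdZ c p : quad_dvd p -> quad_dvd (c *: p).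
Proof. by move=> [u ->]; exists (c *: u); rewrite scalerAr. Qed.

Lemma quad_dvd_raise p : quad_dvd p -> quad_dvd (raise p).
Proof.
by move=> [u ->]; exists (raise u); rewrite raiseM raise_quad mul0r add0r.
Qed.

Lemma quad_dvd_lower p : quad_dvd p -> quad_dvd (lower p).
Proof.
by move=> [u ->]; exists (lower u); rewrite lowerM lower_quad mul0r add0r.
Qed.

Lemma weigh_neg_eq0 p (k : nat) : weigh p = - k.+1%:R *: p -> p = 0.
Proof.
move/der_diag_eigen => wp; apply/eqP; rewrite -msupp_eq0.
case: (msupp p) wp => // u s /(_ u (mem_head _ _)) /eqP.
have le0 : 0 <= \sum_(j < N.+1) (u j)%:R * j%:R :> rat.
  by apply: sumr_ge0 => j _; rewrite mulr_ge0 ?ler0n.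
by move/eqP => e; move: le0; rewrite e oppr_ge0 lern0.
Qed.

(* Modulo quad, raise (lower^(j+1) v) = - c_(j+1) lower^j v with c_(j+1) > 0, so
   divisibility by quad descends from lower^(i+1) v = 0 to v. *)
Lemma quad_dvd_of_raise (d i : nat) v :
  euler v = d%:R *: v -> weigh v = i%:R *: v -> (i.*2 < N * d)%N ->
  quad_dvd (raise v) -> quad_dvd v.
Proof.
move=> ev wv lt_i dvd_rv.
pose w j := iter j lower v.
have ew j : euler (w j) = d%:R *: w j.
  by elim: j => //= j IHj; rewrite euler_lower IHj linearZ.
have ww j : weigh (w j) = (i%:R - j%:R) *: w j.
  elim: j => [|j IHj]; first by rewrite subr0.
  by rewrite /= weigh_lower IHj linearZ /= -natr1 opprD addrA [RHS]scalerBl scale1r.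
(* The summand is the scalar N d - 2(i - l) by which the commutator of [lower] and [raise] acts on
   [w l], of weight i - l. *)
pose c : nat -> rat := fun j => \sum_(l < j) ((N * d)%:R - i.*2%:R + l.*2%:R).
have c_gt0 j : 0 < c j.+1.
  rewrite /c big_ord_recl /= addr0 ltr_wpDr ?subr_gt0 ?ltr_nat //.
  by apply: sumr_ge0 => l _; rewrite addr_ge0 ?ler0n // subr_ge0 ler_nat ltnW.
have rw j : quad_dvd (raise (w j.+1) + c j.+1 *: w j).
  elim: j => [|j IHj].
    have -> : raise (w 1%N) + c 1%N *: w 0%N = lower (raise v).
      apply/eqP; rewrite eq_sym -subr_eq0 opprD addrA lower_raise_comm ev wv.
      rewrite !scalerA -scalerBl -scalerBl /c big_ord1 /=.
      apply/eqP; rewrite -[RHS](scale0r v); congr (_ *: _).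
      by rewrite -!mul2n !natrM; ring.
    exact: quad_dvd_lower.
  have -> : raise (w j.+2) + c j.+2 *: w j.+1
            = lower (raise (w j.+1) + c j.+1 *: w j).
    rewrite linearD linearZ /=; apply/eqP; rewrite eq_sym -subr_eq0 opprD addrACA.
    rewrite -[lower (w j)]/(w j.+1) lower_raise_comm ew ww.
    have -> : c j.+2 = c j.+1 + ((N * d)%:R - i.*2%:R + j.+1.*2%:R).
      by rewrite /c big_ord_recr.
    rewrite !scalerA -!scalerBl -scalerDl.
    apply/eqP; rewrite -[RHS](scale0r (w j.+1)); congr (_ *: _).
    by rewrite -!mul2n !natrM -!natr1; ring.
  exact: quad_dvd_lower.
(* The descent starts at [w i.+1], which would have weight -1 and therefore vanishes. *)
suff: forall k, quad_dvd (w k) -> quad_dvd v.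
  move/(_ i.+1); apply; exists 0; rewrite mulr0; apply: (@weigh_neg_eq0 _ 0).
  by rewrite ww -natr1 opprD addrA subrr add0r.
elim=> // k IHk dvd_wk; apply: IHk.
have -> : w k = (c k.+1)^-1 *:
    ((raise (w k.+1) + c k.+1 *: w k) + -1 *: raise (w k.+1)).
  by rewrite scaleN1r addrAC subrr add0r scalerA mulVf ?scale1r // gt_eqF.
apply/quad_dvdZ/quad_dvdD => //; apply/quad_dvdZ.
exact: quad_dvd_raise.
Qed.
End SL2.

(** * Dimension counts for families of polynomials *)

Section Independence.
Variable n : nat.

Lemma lin_monomials_eq0 (S : seq 'X_{1..n}) (g : 'X_{1..n} -> 'X_{1..n})
    (a : 'X_{1..n} -> rat) :
  uniq S -> {in S &, injective g} -> \sum_(s <- S) a s *: 'X_[g s] = 0 ->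
  forall s, s \in S -> a s = 0.
Proof.
move=> uniqS injg sum0 s sS; have := congr1 (mcoeff (g s)) sum0.
rewrite raddf_sum mcoeff0 (bigD1_seq s) //= mcoeffZ mcoeffX eqxx mulr1.
rewrite big_seq_cond big1 ?addr0 // => t /andP[tS ne_ts].
rewrite mcoeffZ mcoeffX.
case: eqP => [/(injg _ _ tS sS) eq_ts|]; last by rewrite mulr0.
by rewrite eq_ts eqxx in ne_ts.
Qed.

(** The coefficient matrix with rows [S] and columns [T] has independent rows, so its rank [size S]
    is at most its number of columns. *)
Lemma size_indep (S T : seq 'X_{1..n}) (f : 'X_{1..n} -> {mpoly rat[n]}) :
  uniq S -> (forall s, s \in S -> {subset msupp (f s) <= T}) ->
  (forall a : 'X_{1..n} -> rat, \sum_(s <- S) a s *: f s = 0 ->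
     forall s, s \in S -> a s = 0) ->
  (size S <= size T)%N.
Proof.
move=> uniqS suppf indep.
pose A := \matrix_(i < size S, j < size T)
  (f (tnth (in_tuple S) i))@_(tnth (in_tuple T) j).
suff /eqP <- : row_free A by exact: rank_leq_col.
apply: inj_row_free => v vA0; apply/rowP => i; rewrite mxE.
(* The row vector [v] becomes a function on all monomials, with value 0 outside [S]. *)
pose a s := if insub (index s S) is Some k then v 0 k else 0.
have aE k : a (tnth (in_tuple S) k) = v 0 k.
  by rewrite /a (tnth_nth (tnth (in_tuple S) k)) index_uniq // valK.
rewrite -aE; apply: indep; last exact: mem_tnth.
have coef u : (\sum_(s <- S) a s *: f s)@_u
    = \sum_k v 0 k * (f (tnth (in_tuple S) k))@_u.
  rewrite raddf_sum big_tnth; apply: eq_bigr => k _.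
  by rewrite /= mcoeffZ aE.
apply/mpolyP => u; rewrite coef mcoeff0.
have [/seq_tnthP[j ->]|uT] := boolP (u \in T).
  have := congr1 (fun B : 'rV_(size T) => B 0 j) vA0.
  rewrite !mxE => e; rewrite -[RHS]e.
  by apply: eq_bigr => k _; rewrite mxE.
apply: big1 => k _; rewrite [_@__](_ : _ = 0) ?mulr0 //.
apply/eqP; rewrite mcoeff_eq0; apply: contra uT; apply: suppf.
exact: mem_tnth.
Qed.
End Independence.

(** * Weights and enumeration of monomials *)

Section Monomials.
Variable N : nat.
Notation mon := 'X_{1..N.+1}.
Implicit Types u : mon.

Definition wt u := (\sum_(j < N.+1) u j * j)%N.

Lemma wtD u v : wt (u + v)%MM = (wt u + wt v)%N.
Proof. by rewrite -big_split; apply: eq_bigr => j _; rewrite mnmDE mulnDl. Qed.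

Lemma wt0 : wt 0%MM = 0%N.
Proof. by rewrite /wt big1 // => j _; rewrite mnm0E. Qed.

Lemma wt1 (j : 'I_N.+1) : wt U_(j)%MM = j.
Proof.
rewrite /wt (bigD1 j) //= mnm1E eqxx mul1n big1 ?addn0 // => i ne_ij.
by rewrite mnm1E eq_sym (negbTE ne_ij).
Qed.

Lemma weighX u : weigh 'X_[u] = (wt u)%:R *: 'X_[u].
Proof.
rewrite /weigh derX /wt natr_sum; congr (_ *: _).
by apply: eq_bigr => j _; rewrite natrM.
Qed.

Lemma eulerX u : euler 'X_[u] = (mdeg u)%:R *: 'X_[u].
Proof.
rewrite /euler derX mdegE natr_sum; congr (_ *: _).
by apply: eq_bigr => j _; rewrite mulr1.
Qed.

(** Splitting on whether [x_(r-1)] occurs mirrors the q-Pascal rule used in [gfS]. The inner [fix]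
    serves the calls that lower [d] while keeping [r]. *)
Fixpoint mons (r d : nat) {struct r} : seq mon :=
  if r is r'.+1 then
    (fix mons_r d := if d is d'.+1 then
       mons r' d'.+1 ++ [seq (U_(inord r') + u)%MM | u <- mons_r d']
     else [:: 0%MM]) d
  else if d is 0 then [:: 0%MM] else [::].

Lemma monsS r d :
  mons r.+1 d.+1 = mons r d.+1 ++ [seq (U_(inord r) + u)%MM | u <- mons r.+1 d].
Proof. by []. Qed.

Lemma mons0 r : mons r 0 = [:: 0%MM].
Proof. by case: r. Qed.

Lemma mem_mons r d u : (r <= N.+1)%N ->
  (u \in mons r d) =
  (mdeg u == d) && [forall j : 'I_N.+1, (r <= j)%N ==> (u j == 0%N)].
Proof.
have z0 s : [forall j : 'I_N.+1, (s <= j)%N ==> ((0%MM : mon) j == 0%N)].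
  by apply/forallP => j; rewrite mnm0E eqxx implybT.
elim: r d u => [|r IHr] d u le_rN.
  apply/idP/andP => [|[/eqP du /forallP u0]].
    by case: d => [|d]; rewrite [mons _ _]/= ?inE // => /eqP->; rewrite mdeg0 z0.
  have e : u = 0%MM by apply/mnmP => j; rewrite mnm0E; exact/eqP/(implyP (u0 j)).
  by move: du; rewrite e mdeg0 => <-; rewrite inE.
elim: d u => [|d IHd] u.
  rewrite mons0 inE mdeg_eq0; case: eqP => //= ->; exact/esym/z0.
have val_r : (inord r : 'I_N.+1) = r :> nat by rewrite inordK.
rewrite monsS mem_cat IHr ?(ltnW le_rN) //.
apply/orP/andP => [[/andP[-> /forallP u0]|/mapP[w]]|[du /forallP u0]].
- split=> //; apply/forallP => j; apply/implyP => lt_rj.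
  exact/(implyP (u0 j))/ltnW.
- rewrite IHd => /andP[/eqP dw /forallP w0] ->; rewrite mdegD mdeg1 dw; split=> //.
  apply/forallP => j; apply/implyP => lt_rj.
  rewrite mnmDE (eqP (implyP (w0 j) lt_rj)).
  have ne_rj : (inord r == j) = false by rewrite -val_eqE /= val_r ltn_eqF.
  by rewrite mnm1E ne_rj.
have [ur|ur] := posnP (u (inord r)).
  left; rewrite du; apply/forallP => j; apply/implyP.
  rewrite leq_eqVlt => /predU1P[eq_rj|lt_rj]; last exact: (implyP (u0 j)).
  have -> : j = inord r by apply: val_inj; rewrite /= val_r eq_rj.
  by rewrite ur.
right; have le_ru : (U_(inord r) <= u)%MM by rewrite lep1mP -lt0n.
apply/mapP; exists (u - U_(inord r))%MM; last by rewrite addmC submK.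
rewrite IHd; apply/andP; split.
  by rewrite -(eqn_add2r 1) -{1}(mdeg1 (inord r : 'I_N.+1)) -mdegD submK // addn1.
apply/forallP => j; apply/implyP => lt_rj.
by rewrite mnmBE (eqP (implyP (u0 j) lt_rj)).
Qed.

Lemma uniq_mons r d : (r <= N.+1)%N -> uniq (mons r d).
Proof.
elim: r d => [|r IHr] d le_rN; first by case: d.
elim: d => [|d IHd]; first by rewrite mons0.
rewrite monsS cat_uniq IHr 1?ltnW //= map_inj_uniq ?IHd; last exact: addmI.
rewrite andbT; apply/hasPn => _ /mapP[w _ ->]; rewrite mem_mons ?(ltnW le_rN) //.
apply/nandP; right; apply/forallPn; exists (inord r).
by rewrite inordK // leqnn mnmDE mnm1E eqxx.
Qed.

Lemma mem_monsT d u : (u \in mons N.+1 d) = (mdeg u == d).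
Proof.
rewrite mem_mons //; case: eqP => //= _; apply/forallP => j.
by rewrite leqNgt ltn_ord.
Qed.

Lemma msupp_bihom (p : {mpoly rat[N.+1]}) (d i : nat) u :
  euler p = d%:R *: p -> weigh p = i%:R *: p -> u \in msupp p ->
  mdeg u = d /\ wt u = i.
Proof.
move=> /der_diag_eigen ep /der_diag_eigen wp up.
split; apply/eqP; rewrite -(eqr_nat rat).
  rewrite -(ep u up) mdegE natr_sum; apply/eqP.
  by apply: eq_bigr => j _; rewrite mulr1.
rewrite -(wp u up) /wt natr_sum; apply/eqP.
by apply: eq_bigr => j _; rewrite natrM.
Qed.

End Monomials.
Arguments mons : simpl never.

(** * Normal monomials modulo the quadratic form, and growth below the middle weight *)

Section Unimodality.
Variable N : nat.
Hypotheses (N_gt0 : (0 < N)%N) (evenN : ~~ odd N).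
Notation mon := 'X_{1..N.+1}.
Implicit Types u : mon.

Definition corner : mon := (U_(ord0) + U_(ord_max))%MM.

Definition quad_mon (j : 'I_N.+1) : mon := (U_(j) + U_(rev_ord j))%MM.

Lemma quadE :
  quad N = \sum_(j < N.+1) ((-1) ^+ j * 'C(N, j)%:R) *: 'X_[quad_mon j].
Proof.
by apply: eq_bigr => j _; rewrite /quad_mon mpolyXD !x_val.
Qed.

Lemma rev_ord_eq0 (j : 'I_N.+1) : (rev_ord j == ord0) = (j == ord_max).
Proof.
rewrite -(inj_eq rev_ord_inj) rev_ordK; congr (_ == _).
by apply: val_inj; rewrite /= subn1.
Qed.

Lemma quad_mon_corner j : (quad_mon j == corner) = (j == ord0) || (j == ord_max).
Proof.
apply/eqP/orP => [eq_m|[] /eqP ->].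
- have := congr1 (fun u : mon => u ord0) eq_m; rewrite !mnmE eqxx.
  have [->|nj0] := eqVneq j ord0; first by left.
  have [->|njN] := eqVneq j ord_max; first by right.
  by rewrite rev_ord_eq0 (negbTE njN); case: (ord_max == ord0).
- by congr (_ + U_(_))%MM; apply: val_inj; rewrite /= subn1.
by rewrite /corner addmC; congr (_ + U_(_))%MM; apply: val_inj; rewrite /= subnn.
Qed.

(** The terms j = 0 and j = N are distinct as N > 0, and each contributes 1, the second because
    (-1)^N = 1. *)
Lemma quad_corner : (quad N)@_corner = 2.
Proof.
rewrite quadE raddf_sum.
have ne : ord_max != ord0 :> 'I_N.+1 by rewrite -val_eqE /= -lt0n.
rewrite (bigD1 ord0) //= (bigD1 ord_max) //= big1 => [|j /andP[nj0 njN]].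
  rewrite !mcoeffZ !mcoeffX !quad_mon_corner !eqxx orbT !mulr1 bin0 binn addr0.
  by rewrite /= expr0 -signr_odd (negbTE evenN) !mulr1.
by rewrite mcoeffZ mcoeffX quad_mon_corner (negbTE nj0) (negbTE njN) mulr0.
Qed.

Lemma quad_neq0 : quad N != 0.
Proof.
apply/eqP => q0; have := quad_corner; rewrite q0 mcoeff0 => /eqP.
by rewrite eq_sym pnatr_eq0.
Qed.

(** All monomials of [quad] have degree 2, so the order first compares exponents of [x_0], and only
    [corner] involves [x_0]. *)
Lemma mlead_quad : mlead (quad N) = corner.
Proof.
apply/le_anti/andP; split; last first.
  by apply: msupp_le_mlead; rewrite mcoeff_msupp quad_corner pnatr_eq0.
have : mlead (quad N) \in msupp (quad N) by rewrite mlead_supp ?quad_neq0.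
rewrite [X in _ \in msupp X]quadE => /msupp_sum_le /flatten_mapP[j _].
move=> /msuppZ_le; rewrite msuppX inE => /eqP->.
have [/eqP -> //|] := boolP (quad_mon j == corner).
rewrite quad_mon_corner negb_or => /andP[nj0 njN]; apply/ltW/ltmcP.
  by rewrite !mdegD !mdeg1.
exists ord0 => [i|]; first by rewrite ltn0.
by rewrite !mnmDE !mnm1E eqxx (negbTE nj0) rev_ord_eq0 (negbTE njN).
Qed.

(** Leading monomials multiply, so that of a nonzero multiple of [quad] is divisible by [corner].
    Thus normal monomials are independent modulo [quad]. *)
Lemma quad_dvd_normal p :
  quad_dvd p -> (forall u, u \in msupp p -> ~~ (corner <= u)%MM) -> p = 0.
Proof.
move=> [q ->] normal; have [->|nz_q] := eqVneq q 0; first by rewrite mulr0.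
have := mlead_supp (mulf_neq0 quad_neq0 nz_q).
by move/normal; rewrite mleadM ?quad_neq0 // mlead_quad lem_addr ?lepm_refl.
Qed.

Lemma weigh_quad : weigh (quad N) = N%:R *: quad N.
Proof.
rewrite quadE linear_sum scaler_sumr; apply: eq_bigr => j _.
rewrite linearZ /= weighX wtD !wt1 /= subSS subnKC -1?ltnS //.
by rewrite !scalerA mulrC.
Qed.

Lemma euler_quad : euler (quad N) = 2 *: quad N.
Proof.
rewrite quadE linear_sum scaler_sumr; apply: eq_bigr => j _.
by rewrite linearZ /= eulerX mdegD !mdeg1 !scalerA mulrC.
Qed.

(* [corner] is the leading monomial of [quad], so these monomials index a basis
   of a weight space of the quotient by [quad]. *)
Definition normal_mons d i :=
  [seq u <- mons N N.+1 d | ~~ (corner <= u)%MM & wt u == i].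

(** Instead of forming the quotient, the count takes place in the full space of degree [d] and
    weight i + 1. The raised normal monomials of weight i and the multiples of [quad] indexed by [R]
    are jointly independent there; cancelling [size R] gives the bound. *)
Lemma size_normal_mons_incr d i :
  (i.*2 < N * d)%N -> (size (normal_mons d i) <= size (normal_mons d i.+1))%N.
Proof.
move=> lt_i.
pose R := [seq u <- mons N N.+1 d | (corner <= u)%MM & wt u == i.+1].
pose T := [seq u <- mons N N.+1 d | wt u == i.+1].
have sizeT : size T = (size (normal_mons d i.+1) + size R)%N.
  rewrite -(count_predC (fun u => corner <= u)%MM T) !count_filter addnC.
  by rewrite !size_filter.
suff: (size (normal_mons d i ++ R) <= size T)%N.
  by rewrite size_cat sizeT leq_add2r.
have memC u : u \in normal_mons d i ->
    [/\ mdeg u = d, wt u = i & ~~ (corner <= u)%MM].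
  by rewrite mem_filter mem_monsT => /andP[/andP[-> /eqP->] /eqP->].
have memR u : u \in R -> [/\ mdeg u = d, wt u = i.+1 & (corner <= u)%MM].
  by rewrite mem_filter mem_monsT => /andP[/andP[-> /eqP->] /eqP->].
have memT u : mdeg u = d -> wt u = i.+1 -> u \in T.
  by move=> du wu; rewrite mem_filter mem_monsT du wu !eqxx.
have uniqC : uniq (normal_mons d i) by apply/filter_uniq/uniq_mons.
have uniqR : uniq R by apply/filter_uniq/uniq_mons.
(* One function covers both index lists, which the weight tells apart. *)
pose f u := if wt u == i then raise 'X_[u] else quad N * 'X_[u - corner].
have fC u : u \in normal_mons d i -> f u = raise 'X_[u].
  by move=> /memC[_ wu _]; rewrite /f wu eqxx.
have fR u : u \in R -> f u = quad N * 'X_[u - corner].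
  by move=> /memR[_ wu _]; rewrite /f wu gtn_eqF.
apply: (@size_indep _ _ _ f).
- rewrite cat_uniq uniqC uniqR andbT; apply/hasPn => u /memR[_ wu _].
  by apply/negP => /memC[_]; rewrite wu => /eqP; rewrite gtn_eqF.
- move=> s; rewrite mem_cat => /orP[sC|sR] u.
    have [ds ws _] := memC _ sC; rewrite fC // => us.
    have [|||du wu] := @msupp_bihom _ (raise 'X_[s]) d i.+1 u;
      last exact: memT.
    + by rewrite euler_raise eulerX ds linearZ.
    + by rewrite weigh_raise weighX ws linearZ /= -natr1 scalerDl scale1r.
    + exact: us.
  have [ds ws cs] := memR _ sR; rewrite fR // => us.
  have eq_s : s = (corner + (s - corner))%MM by rewrite addmC submK.
  have [|||du wu] := @msupp_bihom _ (quad N * 'X_[s - corner]) d i.+1 u;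
    last exact: memT.
  + rewrite eulerM euler_quad eulerX -scalerAl -scalerAr -scalerDl.
    rewrite -ds -natrD [mdeg s](_ : _ = 2 + mdeg (s - corner))%N //.
    by rewrite {1}eq_s mdegD [mdeg corner]mdegD !mdeg1.
  + rewrite weighM weigh_quad weighX -scalerAl -scalerAr -scalerDl.
    rewrite -ws -natrD [wt s](_ : _ = N + wt (s - corner))%N //.
    by rewrite {1}eq_s wtD [wt corner]wtD !wt1.
  + exact: us.
move=> a; rewrite big_cat /=.
pose v : {mpoly rat[N.+1]} := \sum_(s <- normal_mons d i) a s *: 'X_[s].
pose w : {mpoly rat[N.+1]} := \sum_(s <- R) a s *: 'X_[s - corner].
have -> : \sum_(s <- normal_mons d i) a s *: f s = raise v.
  rewrite linear_sum; apply: eq_big_seq => s sC.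
  by rewrite fC // linearZ.
have -> : \sum_(s <- R) a s *: f s = quad N * w.
  rewrite mulr_sumr; apply: eq_big_seq => s sR.
  by rewrite fR // scalerAr.
move=> sum0.
(* Here [raise v = - quad * w], so [quad] divides [v] by injectivity of [raise] modulo [quad]; but
   [v] is a combination of normal monomials. *)
have v0 : v = 0.
  apply: quad_dvd_normal => [|u].
    apply: (@quad_dvd_of_raise _ d i) => //.
    - rewrite linear_sum scaler_sumr; apply: eq_big_seq => s /memC[ds _ _].
      by rewrite linearZ /= eulerX ds !scalerA mulrC.
    - rewrite linear_sum scaler_sumr; apply: eq_big_seq => s /memC[_ ws _].
      by rewrite linearZ /= weighX ws !scalerA mulrC.
    - exists (- w); rewrite mulrN; apply/eqP; rewrite -addr_eq0; exact/eqP.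
  move/msupp_sum_le => /flatten_mapP[s]; rewrite mem_filter /= => sC /msuppZ_le.
  by rewrite msuppX inE => /eqP->; case: (memC _ sC).
have w0 : w = 0.
  move/eqP: sum0; rewrite v0 linear0 add0r mulf_eq0 (negbTE quad_neq0).
  by move/eqP.
move=> s; rewrite mem_cat => /orP[sC|sR].
  exact: (@lin_monomials_eq0 _ (normal_mons d i) id a).
apply: (@lin_monomials_eq0 _ R (fun s => s - corner)%MM a) => //.
move=> t1 t2 /memR[_ _ c1] /memR[_ _ c2] e.
by rewrite -(submK c1) -(submK c2) e.
Qed.
End Unimodality.

(** * Symmetry under reversal of the variables *)

Section Symmetry.
Variable N : nat.
Hypothesis N_gt0 : (0 < N)%N.
Notation mon := 'X_{1..N.+1}.
Implicit Types u : mon.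

Lemma corner_leE u : (corner N <= u)%MM = (0 < u ord0)%N && (0 < u ord_max)%N.
Proof.
have ne : (ord_max == ord0 :> 'I_N.+1) = false.
  by rewrite -val_eqE /= gtn_eqF.
apply/mnm_lepP/andP => [le_cu | [u0 uN] j].
  have := le_cu ord0; have := le_cu ord_max.
  by rewrite !mnmDE !mnm1E !eqxx ne eq_sym ne.
rewrite mnmDE !mnm1E; have [<-|nj0] := eqVneq; first by rewrite ne.
by case: eqP => // <-.
Qed.

Definition mrev u : mon := [multinom u (rev_ord j) | j < N.+1].

Lemma mrevK : involutive mrev.
Proof. by move=> u; apply/mnmP => j; rewrite !mnmE rev_ordK. Qed.

Lemma mdeg_mrev u : mdeg (mrev u) = mdeg u.
Proof.
rewrite !mdegE (reindex_inj rev_ord_inj); apply: eq_bigr => j _.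
by rewrite mnmE rev_ordK.
Qed.

Lemma wt_mrev u : (wt (mrev u) + wt u = N * mdeg u)%N.
Proof.
rewrite /wt (reindex_inj rev_ord_inj) -big_split mdegE big_distrr.
apply: eq_bigr => j _; rewrite mnmE rev_ordK /=.
rewrite -mulnDr subSS subnK; last by rewrite -ltnS.
exact: mulnC.
Qed.

Lemma corner_le_mrev u : (corner N <= mrev u)%MM = (corner N <= u)%MM.
Proof.
rewrite !corner_leE !mnmE andbC; congr ((0 < u _)%N && (0 < u _)%N).
  by apply: val_inj; rewrite /= subSS subnn.
by apply: val_inj; rewrite /= subn1.
Qed.

(** The involution [mrev] preserves degree and normality and complements the weight. The inequality
    it yields is applied at i and at N d - i. *)
Lemma size_normal_mons_sym d i : (i <= N * d)%N ->
  size (normal_mons N d i) = size (normal_mons N d (N * d - i)%N).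
Proof.
have le_size j : (j <= N * d)%N ->
    (size (normal_mons N d j) <= size (normal_mons N d (N * d - j)%N))%N.
  move=> le_j; rewrite -(size_map mrev); apply: uniq_leq_size.
    by rewrite (map_inj_uniq (inv_inj mrevK)); apply/filter_uniq/uniq_mons.
  move=> _ /mapP[u uj ->]; move: uj; rewrite !mem_filter !mem_monsT.
  move=> /andP[/andP[nu /eqP wu] /eqP du].
  rewrite corner_le_mrev nu mdeg_mrev du eqxx andbT /=.
  by rewrite -du -(wt_mrev u) wu addnK.
move=> le_i; apply/anti_leq; rewrite le_size //=.
by rewrite -{2}(subKn le_i) le_size // leq_subr.
Qed.
End Symmetry.

(** * Weight generating functions of monomials *)

Section GeneratingFunctions.
Variable N : nat.
Notation mon := 'X_{1..N.+1}.
Implicit Types u : mon.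

(** The q-Pochhammer symbol (q; q)_n, that is, the q-factorial times (1 - q)^n. *)
Definition qfact n : {poly rat} := \prod_(i < n) (1 - 'X^(i.+1)).

Lemma qfactS n : qfact n.+1 = qfact n * (1 - 'X^(n.+1)).
Proof. by rewrite /qfact big_ord_recr. Qed.

Lemma qfact0 : qfact 0 = 1.
Proof. by rewrite /qfact big_ord0. Qed.

Lemma one_sub_Xn_neq0 n : (0 < n)%N -> 1 - 'X^n != 0 :> {poly rat}.
Proof.
move=> n_gt0; apply/eqP => /(congr1 (coefp 0)) /=.
by rewrite coefB coef1 coefXn coef0 (ltn_eqF n_gt0) subr0 => /eqP; rewrite oner_eq0.
Qed.

Lemma qfact_neq0 n : qfact n != 0.
Proof. by apply/prodf_neq0 => i _; exact: one_sub_Xn_neq0. Qed.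

Definition gf r d : {poly rat} := \sum_(u <- mons N r d) 'X^(wt u).

Lemma gf0 r : gf r 0 = 1.
Proof. by rewrite /gf mons0 big_seq1 wt0. Qed.

Lemma gfS r d : (r <= N)%N -> gf r.+1 d.+1 = gf r d.+1 + 'X^r * gf r.+1 d.
Proof.
move=> le_rN; rewrite /gf monsS big_cat big_map mulr_sumr; congr (_ + _).
by apply: eq_bigr => u _; rewrite wtD wt1 inordK // exprD.
Qed.

(** The Gaussian polynomial with denominators cleared, by double induction on the q-Pascal rule. The
    step is (1 - q^(r+1)) + q^(r+1) (1 - q^(d+1)) = 1 - q^(r+d+2). *)
Lemma qfact_gf r d : (r <= N)%N -> qfact d * qfact r * gf r.+1 d = qfact (d + r).
Proof.
elim: r d => [|r IHr] d le_rN.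
  suff -> : gf 1 d = 1 by rewrite qfact0 !mulr1 addn0.
  elim: d => [|d IHd]; first exact: gf0.
  by rewrite gfS // IHd expr0 mul1r /gf big_nil add0r.
elim: d => [|d IHd]; first by rewrite gf0 qfact0 mul1r mulr1.
rewrite gfS // mulrDr.
have -> : qfact d.+1 * qfact r.+1 * gf r.+1 d.+1
          = (1 - 'X^(r.+1)) * qfact (d + r).+1.
  rewrite -addSn -(IHr d.+1 (ltnW le_rN)) (qfactS r); ring.
have -> : qfact d.+1 * qfact r.+1 * ('X^(r.+1) * gf r.+2 d)
          = 'X^(r.+1) * (1 - 'X^(d.+1)) * qfact (d + r).+1.
  rewrite -addnS -IHd (qfactS d); ring.
rewrite addSn addnS (qfactS (d + r).+1).
have -> : (d + r).+2 = (r.+1 + d.+1)%N by lia.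
by rewrite exprD; ring.
Qed.

Definition gf_normal d : {poly rat} :=
  \sum_(u <- mons N N.+1 d | ~~ (corner N <= u)%MM) 'X^(wt u).

Lemma coef_gf_normal d i : (gf_normal d)`_i = (size (normal_mons N d i))%:R.
Proof.
rewrite /gf_normal coef_sum size_filter -sum1_count natr_sum.
rewrite [LHS]big_mkcond [RHS]big_mkcond; apply: eq_bigr => u _ /=.
rewrite coefXn eq_sym; case: (corner N <= u)%MM => //=.
by case: (wt u == i).
Qed.

(** Dividing by [corner], of degree 2 and weight N, matches the non-normal monomials with all
    monomials of degree [d]. *)
Lemma gf_split d : gf N.+1 d.+2 = 'X^N * gf N.+1 d + gf_normal d.+2.
Proof.
rewrite /gf (bigID (fun u => (corner N <= u)%MM)) /=; congr (_ + _).
rewrite -big_filter mulr_sumr.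
rewrite (perm_big [seq (corner N + u)%MM | u <- mons N N.+1 d]) /=.
  rewrite big_map; apply: eq_bigr => u _.
  by rewrite wtD [wt (corner N)]wtD !wt1 exprD.
apply: uniq_perm; first by apply/filter_uniq/uniq_mons.
  by rewrite map_inj_uniq ?uniq_mons //; exact: addmI.
move=> u; rewrite mem_filter mem_monsT; apply/andP/mapP => [[cu /eqP du]|[v]].
  exists (u - corner N)%MM; last by rewrite addmC submK.
  rewrite mem_monsT -(eqn_add2r (mdeg (corner N))) -mdegD submK // du.
  by rewrite mdegD !mdeg1 addn2.
rewrite mem_monsT => /eqP dv ->; rewrite mdegD [mdeg (corner N)]mdegD !mdeg1 dv.
by rewrite lem_addr ?lepm_refl.
Qed.
End GeneratingFunctions.

(** * Gaussian polynomials and q-Kaplansky numbers as generating functions *)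

Lemma prod_falling (n m : nat) : (m <= n)%N ->
  qfact (n - m) * \prod_(i < m) (1 - 'X^(n - i)) = qfact n.
Proof.
elim: m => [|m IHm] le_mn; first by rewrite subn0 big_ord0 mulr1.
rewrite -IHm 1?ltnW // big_ord_recr -(subnSK le_mn) qfactS /=.
by rewrite subnSK //; ring.
Qed.

(** The ambient [N] stays free because [Kq_gf_normal] takes N = n - m + 1, one variable more than
    occurs here. *)
Lemma gauss_gf N n m : (m <= n)%N -> (n - m <= N)%N ->
  gauss n m = gf N (n - m).+1 m.
Proof.
move=> le_mn le_N; have := prod_falling (leqnn m); rewrite subnn qfact0 mul1r.
rewrite /gauss => ->.
have -> : \prod_(i < m) (1 - 'X^(n - i)) = gf N (n - m).+1 m * qfact m.
  apply: (mulfI (qfact_neq0 (n - m))); rewrite prod_falling //.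
  by rewrite -[in LHS](subnKC le_mn) -(qfact_gf _ le_N); ring.
by rewrite mulpK // qfact_neq0.
Qed.

(** By [gf_split] the right side is a difference of two Gaussian polynomials; clearing denominators
    with [qfact_gf] leaves an identity of products. *)
Lemma Kq_gf_normal n m : (2 <= m)%N -> (m <= n)%N ->
  Kq n m = gf_normal (n - m).+1 m.
Proof.
case: m => [|[|d]] // _ le_mn; set k := (n - d.+2)%N; set N := k.+1.
have le_kN : (k <= N)%N by [].
have n_gt0 : (0 < n)%N by apply: leq_trans le_mn.
rewrite /Kq (gauss_gf le_mn le_kN) -/k.
suff -> : (1 - 'X^(n + d.+2)) * gf N k.+1 d.+2 = gf_normal N d.+2 * (1 - 'X^n).
  by rewrite mulpK // one_sub_Xn_neq0.
have nE : n = (d.+2 + k)%N by rewrite subnKC.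
apply: (mulfI (mulf_neq0 (qfact_neq0 d.+2) (qfact_neq0 k.+1))).
have -> : gf_normal N d.+2 = gf N N.+1 d.+2 - 'X^N * gf N N.+1 d.
  by rewrite gf_split addrC addKr.
have e1 := qfact_gf d.+2 le_kN; have e2 := qfact_gf d.+2 (leqnn N).
have e3 := qfact_gf d (leqnn N).
transitivity ((1 - 'X^(n + d.+2)) * (1 - 'X^(k.+1)) * qfact (d.+2 + k)).
  by rewrite -e1 (qfactS k); ring.
transitivity ((qfact (d.+2 + N)
   - 'X^N * (1 - 'X^(d.+1)) * (1 - 'X^(d.+2)) * qfact (d + N))
   * (1 - 'X^n)); last first.
  by rewrite -e2 -e3 !(qfactS d.+1, qfactS d) /N; ring.
(* Every q-factorial becomes a multiple of [qfact (d + k).+1], leaving an identity in q, q^d and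
   q^k. *)
rewrite /N !addSn !addnS !(qfactS (d + k).+2, qfactS (d + k).+1) nE.
rewrite ?addSn ?addnS !exprS !exprD; ring.
Qed.

Theorem theorem1p5 (n m : nat) :
  (2 <= m)%N -> (m <= n)%N -> odd (n - m) ->
  let D := (m * (n - m) + m)%N in
  let c := fun i : nat => (Kq n m)`_i in
  (forall i : nat, (i <= D)%N -> c i = c (D - i)%N) /\
  (forall i : nat, (i < D./2)%N -> c i <= c i.+1) /\
  (forall i : nat, (D./2 <= i)%N -> (i < D)%N -> c i.+1 <= c i).
Proof.
move=> le2m le_mn odd_nm D c; set N := (n - m).+1.
have N_gt0 : (0 < N)%N by [].
have evenN : ~~ odd N by rewrite /= negbK.
have DE : D = (N * m)%N by rewrite /D /N; lia.
have cE i : c i = (size (normal_mons N m i))%:R.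
  by rewrite /c Kq_gf_normal // coef_gf_normal.
have sym i : (i <= D)%N -> c i = c (D - i)%N.
  by rewrite DE => le_i; rewrite !cE (size_normal_mons_sym N_gt0 le_i).
(* Evenness of [D] makes D - i - 1 < D/2 follow from D/2 <= i, so the descending half is the
   reflected ascending half. *)
have evenD : ~~ odd D by rewrite DE oddM (negbTE evenN).
have incr i : (i < D./2)%N -> c i <= c i.+1.
  move=> lt_i; rewrite !cE ler_nat; apply: size_normal_mons_incr => //.
  by rewrite -DE; lia.
split=> //; split=> // i le_i lt_i.
rewrite (sym i.+1) // (sym i) 1?ltnW //.
have -> : (D - i)%N = (D - i.+1).+1 by lia.
by apply: incr; lia.
Qed.
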